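(* Let $a,\Lambda_0\in\mathbb{R}$ and let $\Sigma$ be a helicoidal surface in $\mathbb{R}^3$ with vertical axis (the $x_3$-axis), oriented by a unit normal $\nu$. Then $\Sigma$ is a critical point of the functional $\mathcal{E}_{a,\Lambda_0}$ if and only if the function $$2\hat Q+\Lambda_0R^2-\frac{a}{4}R^4$$ is constant on $\Sigma$, where $R^2=x_1^2+x_2^2$ and $\hat Q=x_1\nu_1+x_2\nu_2$.
   Context: A helicoidal surface (with vertical axis) is a smooth oriented immersed surface in $\mathbb{R}^3$ invariant under a one-parameter helicoidal group $(x_1+ix_2,x_3)\mapsto(e^{-i\omega t}(x_1+ix_2),x_3+t)$, $t\in\mathbb{R}$, for some $\omega>0$; it is the orbit of a planar generating curve $\alpha$ (the profile curve) under this group. For an immersed oriented surface $\Sigma$ with unit normal $\nu=(\nu_1,\nu_2,\nu_3)$, the energy is $$\mathcal{E}_{a,\Lambda_0}=\mathcal{A}-\frac a2\int_\Sigma W\cdot\nu\,d\Sigma+\Lambda_0\int_\Sigma W_0\cdot\nu\,d\Sigma,$$ where $\mathcal{A}$ is the surface area, $W=\frac{R^2}{4}(x_1,x_2,0)$ (so $\operatorname{div}W=R^2$), and $W_0=\frac12(x_1,x_2,0)$ (so $\operatorname{div}W_0=1$). Let $H$ be the mean curvature with respect to $\nu$, with the sign convention $\delta\mathcal{A}=-\int_\Sigma 2H\psi\,d\Sigma$ for compactly supported variations with normal component $\psi=\delta X\cdot\nu$ (so a round cylinder of radius $R$ with inward normal has $2H=1/R$). For such variations $\delta\mathcal{E}_{a,\Lambda_0}=\int_\Sigma(-2H-\frac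 a2R^2+\Lambda_0)\psi\,d\Sigma$, and $\Sigma$ is called a critical point (equilibrium surface) of $\mathcal{E}_{a,\Lambda_0}$ if $2H=\Lambda_0-\frac a2R^2$ on $\Sigma$. With $X$ the position vector and $Q=X\cdot\nu$ the support function, $\hat Q=Q-x_3\nu_3=x_1\nu_1+x_2\nu_2$.
   Formalization: The direction ''constant implies critical'' is stated only when Σ is not contained in a round cylinder about the x3-axis (R not constant); on such cylinders the function is always constant but the surface is generally not critical. Σ is taken connected. *)

(* Defs.v *)
From Stdlib Require Import Reals.
From Coquelicot Require Import Coquelicot.
Open Scope R_scope.

(* Euclidean 3-space as C * R, so that the helicoidal motions can be written
   with complex multiplication in the first factor. *)
Definition R3 : Type := (C * R)%type.

Definition x1 (p : R3) : R := fst (fst p).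
Definition x2 (p : R3) : R := snd (fst p).
Definition x3 (p : R3) : R := snd p.

Definition dot (p q : R3) : R := x1 p * x1 q + x2 p * x2 q + x3 p * x3 q.

(* Parametrized surfaces are maps X : R -> R -> R3 considered on a parameter
   domain D; orientations are given by a normal field nu : R -> R -> R3. *)

Definition partial_s (X : R -> R -> R3) (s t : R) : R3 :=
  ((Derive (fun u => x1 (X u t)) s, Derive (fun u => x2 (X u t)) s),
   Derive (fun u => x3 (X u t)) s).

Definition partial_t (X : R -> R -> R3) (s t : R) : R3 :=
  ((Derive (fun v => x1 (X s v)) t, Derive (fun v => x2 (X s v)) t),
   Derive (fun v => x3 (X s v)) t).

Definition immersion (D : R -> R -> Prop) (X : R -> R -> R3) : Prop :=
  forall s t, D s t ->
  forall c d : R,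
    c * x1 (partial_s X s t) + d * x1 (partial_t X s t) = 0 ->
    c * x2 (partial_s X s t) + d * x2 (partial_t X s t) = 0 ->
    c * x3 (partial_s X s t) + d * x3 (partial_t X s t) = 0 ->
    c = 0 /\ d = 0.

Definition unit_normal (D : R -> R -> Prop) (X nu : R -> R -> R3) : Prop :=
  forall s t, D s t ->
    continuous (fun p : R * R => (nu (fst p) (snd p) : C * R)) (s, t) /\
    dot (nu s t) (nu s t) = 1 /\
    dot (nu s t) (partial_s X s t) = 0 /\
    dot (nu s t) (partial_t X s t) = 0.

(* H = (e G - 2 f F + g E) / (2 (E G - F^2)) in terms of the two fundamental
   forms.  With e = <X_ss, nu> etc., this is the sign for which the first
   variation of area is - int 2 H psi, and for which a round cylinder of
   radius r with inward normal has 2 H = 1 / r. *)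
Definition mean_curvature (X nu : R -> R -> R3) (s t : R) : R :=
  let Xs := partial_s X in
  let Xt := partial_t X in
  let E := dot (Xs s t) (Xs s t) in
  let F := dot (Xs s t) (Xt s t) in
  let G := dot (Xt s t) (Xt s t) in
  let e := dot (partial_s Xs s t) (nu s t) in
  let f := dot (partial_s Xt s t) (nu s t) in
  let g := dot (partial_t Xt s t) (nu s t) in
  (e * G - 2 * f * F + g * E) / (2 * (E * G - F ^ 2)).

(* The square R^2 of the distance to the vertical axis. *)
Definition axis_dist2 (X : R -> R -> R3) (s t : R) : R :=
  x1 (X s t) ^ 2 + x2 (X s t) ^ 2.

(* The horizontal part Q - x3 nu3 of the support function Q = <X, nu>. *)
Definition Qhat (X nu : R -> R -> R3) (s t : R) : R :=
  x1 (X s t) * x1 (nu s t) + x2 (X s t) * x2 (nu s t).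

(* Critical points of
     area - (a/2) int W.nu + Lambda0 int W0.nu,
     W = (R^2/4) (x1, x2, 0),  W0 = (1/2) (x1, x2, 0),
   whose first variation is int (- 2 H - (a/2) R^2 + Lambda0) psi. *)
Definition critical_point (a Lambda0 : R) (D : R -> R -> Prop)
    (X nu : R -> R -> R3) : Prop :=
  forall s t, D s t ->
    2 * mean_curvature X nu s t = Lambda0 - a / 2 * axis_dist2 X s t.

Definition constant_on (D : R -> R -> Prop) (h : R -> R -> R) : Prop :=
  exists c : R, forall s t, D s t -> h s t = c.

(* For a connected surface: contained in a round cylinder about the vertical
   axis. *)
Definition in_round_cylinder (D : R -> R -> Prop) (X : R -> R -> R3) : Prop :=
  constant_on D (axis_dist2 X).

(* The complex number exp (- i theta). *)
Definition expNi (theta : R) : C := (cos theta, - sin theta).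

Definition helicoidal_motion (omega t : R) (p : R3) : R3 :=
  (Cmult (expNi (omega * t)) (fst p), snd p + t).

(* The orbit of the curve alpha, drawn in the plane x3 = 0. *)
Definition helicoidal_orbit (omega : R) (alpha : R -> C) (s t : R) : R3 :=
  helicoidal_motion omega t (alpha s, 0).

Definition in_interval (lo hi : Rbar) (s : R) : Prop :=
  Rbar_lt lo (Finite s) /\ Rbar_lt (Finite s) hi.

Definition strip (lo hi : Rbar) (s t : R) : Prop := in_interval lo hi s.

Definition smooth_curve (lo hi : Rbar) (alpha : R -> C) : Prop :=
  forall (n : nat) (s : R), in_interval lo hi s ->
    ex_derive_n (fun u => fst (alpha u)) n s /\
    ex_derive_n (fun u => snd (alpha u)) n s.

(* A connected surface invariant under the helicoidal group is the product of
   a connected curve (its slice x3 = 0) and the time line of the group.  The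
   curve is parametrized by an open interval, bounded or not; closed curves are
   covered by periodic parametrizations. *)
Definition oriented_helicoidal_surface (omega : R) (lo hi : Rbar)
    (alpha : R -> C) (nu : R -> R -> R3) : Prop :=
  0 < omega /\
  Rbar_lt lo hi /\
  smooth_curve lo hi alpha /\
  immersion (strip lo hi) (helicoidal_orbit omega alpha) /\
  unit_normal (strip lo hi) (helicoidal_orbit omega alpha) nu.

(* Main.v *)
Require Import Defs.
From Stdlib Require Import Reals Lra.
From Coquelicot Require Import Coquelicot.
Open Scope R_scope.

(** The surface is described along its profile curve alpha = (x, y) by the
    quantities rho = R^2 = x^2 + y^2, p = rho' / 2, E = |alpha'|^2 and
    W = E + omega^2 p^2, the Gram determinant of X_s and X_t.  In the frame
    rotating with the helicoidal group the vector X_s x X_t is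
    (y', -x', -omega p), so that nu is this vector times eps / sqrt W for a sign
    eps, which is constant because nu is continuous and the parameter strip is
    connected ([unit_normal_orbit], [orientation_constant]).  Hence Qhat and 2 H
    are eps times functions of s alone ([Qhat_orbit], [mean_curvature_orbit]),
    and a computation gives Qhat' = - 2 H p ([is_derive_profile_support]).
    With phi = 2 H - Lambda0 + (a / 2) rho this says that
    h = 2 Qhat + Lambda0 rho - (a / 4) rho^2 satisfies h' = - 2 p phi
    ([is_derive_first_integral]).  If phi = 0, then h is constant.

    Conversely, let h be constant, so that p phi = 0 everywhere.  This alone does
    not give phi = 0, since p may vanish on a whole interval: the profile might
    be an arc of a circle about the origin, continued by another curve.
    Smoothness rules this out.  Where phi <> 0, p vanishes on a neighbourhood,
    the profile is such an arc and 2 H = - Qhat / rho is stationary there, hence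
    so is phi.  Therefore (phi^2)' = 0 everywhere and phi^2 is a constant
    ([defect_square_constant]).  If this constant is not zero, then p = 0
    everywhere and the surface lies in a round cylinder; otherwise the surface is
    critical. *)

(** * Functions on an open interval *)

Lemma in_interval_locally (lo hi : Rbar) (s : R) :
  in_interval lo hi s -> locally s (in_interval lo hi).
Proof.
  intros [Hlo Hhi].
  apply filter_and; [now apply open_Rbar_gt | now apply open_Rbar_lt].
Qed.

Lemma in_interval_between (lo hi : Rbar) (s s' u : R) :
  in_interval lo hi s -> in_interval lo hi s' -> s <= u <= s' ->
  in_interval lo hi u.
Proof.
  intros [Hlo _] [_ Hhi] [Hsu Hus']; split.
  - apply Rbar_lt_le_trans with s; assumption.
  - apply Rbar_le_lt_trans with s'; assumption.
Qed.

Lemma in_interval_inhabited (lo hi : Rbar) :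
  Rbar_lt lo hi -> exists s, in_interval lo hi s.
Proof.
  unfold in_interval.
  destruct lo as [l| |], hi as [h| |]; simpl; intros Hlt; try tauto.
  - exists ((l + h) / 2); lra.
  - exists (l + 1); lra.
  - exists (h - 1); lra.
  - exists 0; tauto.
Qed.

Lemma derive_zero_constant (lo hi : Rbar) (f : R -> R) :
  (forall s, in_interval lo hi s -> is_derive f s 0) ->
  forall s s', in_interval lo hi s -> in_interval lo hi s' -> f s = f s'.
Proof.
  intros Hf.
  assert (Hlt : forall s s', in_interval lo hi s -> in_interval lo hi s' ->
                  s < s' -> f s = f s').
  { intros s s' Hs Hs' Hss'.
    apply eq_is_derive; [ | exact Hss'].
    intros u Hu; apply Hf, (in_interval_between lo hi s s'); assumption. }
  intros s s' Hs Hs'.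
  destruct (Rtotal_order s s') as [Hss' | [-> | Hss']]; auto.
  symmetry; auto.
Qed.

(** Two values of a function into {1, -1} that differ by less than 1 coincide,
    so that continuity makes it locally constant and its derivative zero. *)
Lemma continuous_sign_constant (lo hi : Rbar) (f : R -> R) :
  (forall s, in_interval lo hi s -> continuous f s) ->
  (forall s, in_interval lo hi s -> f s ^ 2 = 1) ->
  forall s s', in_interval lo hi s -> in_interval lo hi s' -> f s = f s'.
Proof.
  intros Hcont Hsign; apply derive_zero_constant; intros s Hs.
  apply is_derive_ext_loc with (fun _ => f s); [ | apply @is_derive_const].
  assert (Hnear : locally s (fun u => ball (f s) (mkposreal 1 Rlt_0_1) (f u))).
  { apply (Hcont s Hs), locally_ball. }
  generalize (filter_and _ _ Hnear (in_interval_locally lo hi s Hs)).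
  apply filter_imp; intros u [Hu Iu].
  change (Rabs (f u - f s) < 1) in Hu.
  apply Rabs_def2 in Hu.
  pose proof (Hsign s Hs) as Hs1; pose proof (Hsign u Iu) as Hu1.
  assert (Hfac : (f s - f u) * (f s + f u) = 0) by lra.
  apply Rmult_integral in Hfac as [Heq | Hopp]; [lra | nra].
Qed.

(** * The moving frame of the helicoidal group *)

(** The helicoidal motions act on vectors through their linear parts, which are
    rotations about the axis.  In the frame rotating with the group the first
    and second derivatives of the surface have components that do not depend
    on t. *)
Definition frame (omega t u v z : R) : R3 :=
  (Cmult (expNi (omega * t)) (u, v), z).

Lemma frame_surjective (omega t : R) (p : R3) :
  exists u v z, p = frame omega t u v z.
Proof.
  destruct p as [[p1 p2] p3].
  pose proof (sin2_cos2 (omega * t)) as Hrot; unfold Rsqr in Hrot.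
  exists (cos (omega * t) * p1 - sin (omega * t) * p2),
         (sin (omega * t) * p1 + cos (omega * t) * p2), p3.
  unfold frame, expNi, Cmult; simpl; f_equal; f_equal.
  - rewrite <- (Rmult_1_l p1) at 1; rewrite <- Hrot; ring.
  - rewrite <- (Rmult_1_l p2) at 1; rewrite <- Hrot; ring.
Qed.

Lemma frame_horizontal_dot (omega t u v z u' v' z' : R) :
  x1 (frame omega t u v z) * x1 (frame omega t u' v' z') +
  x2 (frame omega t u v z) * x2 (frame omega t u' v' z') = u * u' + v * v'.
Proof.
  pose proof (sin2_cos2 (omega * t)) as Hrot; unfold Rsqr in Hrot.
  unfold frame, x1, x2, expNi, Cmult; simpl.
  rewrite <- (Rmult_1_l (u * u' + v * v')), <- Hrot; ring.
Qed.

Lemma frame_dot (omega t u v z u' v' z' : R) :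
  dot (frame omega t u v z) (frame omega t u' v' z')
  = u * u' + v * v' + z * z'.
Proof. unfold dot; rewrite frame_horizontal_dot; reflexivity. Qed.

Lemma frame_eq0 (omega t u v z : R) :
  u = 0 -> v = 0 -> z = 0 -> frame omega t u v z = ((0, 0), 0).
Proof.
  intros -> -> ->; unfold frame, expNi, Cmult; simpl; repeat f_equal; ring.
Qed.

Lemma partial_s_frame (omega : R) (Y : R -> R -> R3) (f g : R -> R)
    (s t k f' g' : R) :
  locally s (fun u => Y u t = frame omega t (f u) (g u) k) ->
  is_derive f s f' -> is_derive g s g' ->
  partial_s Y s t = frame omega t f' g' 0.
Proof.
  intros HY Hf Hg; unfold partial_s, frame, expNi, Cmult; simpl.
  f_equal; [f_equal | ]; apply is_derive_unique.
  - apply is_derive_ext_loc with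
      (fun u => cos (omega * t) * f u - - sin (omega * t) * g u).
    { revert HY; apply filter_imp; intros u ->; reflexivity. }
    auto_derive.
    + repeat split; [exists f' | exists g']; assumption.
    + rewrite (is_derive_unique (fun x : R => f x) _ _ Hf).
      rewrite (is_derive_unique (fun x : R => g x) _ _ Hg); ring.
  - apply is_derive_ext_loc with
      (fun u => cos (omega * t) * g u + - sin (omega * t) * f u).
    { revert HY; apply filter_imp; intros u ->; reflexivity. }
    auto_derive.
    + repeat split; [exists g' | exists f']; assumption.
    + rewrite (is_derive_unique (fun x : R => f x) _ _ Hf).
      rewrite (is_derive_unique (fun x : R => g x) _ _ Hg); ring.
  - apply is_derive_ext_loc with (fun _ => k); [ | apply @is_derive_const].
    revert HY; apply filter_imp; intros u ->; reflexivity.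
Qed.

Lemma partial_t_frame (omega : R) (Y : R -> R -> R3) (s t u v z d : R) :
  (forall t', Y s t' = frame omega t' u v (z + d * t')) ->
  partial_t Y s t = frame omega t (omega * v) (- (omega * u)) d.
Proof.
  intros HY; unfold partial_t, frame, expNi, Cmult; simpl.
  f_equal; [f_equal | ]; apply is_derive_unique.
  - apply is_derive_ext with
      (fun t' => cos (omega * t') * u - - sin (omega * t') * v).
    { intros t'; rewrite HY; reflexivity. }
    auto_derive; [exact I | ring].
  - apply is_derive_ext with
      (fun t' => cos (omega * t') * v + - sin (omega * t') * u).
    { intros t'; rewrite HY; reflexivity. }
    auto_derive; [exact I | ring].
  - apply is_derive_ext with (fun t' => z + d * t').
    { intros t'; rewrite HY; reflexivity. }
    auto_derive; [exact I | ring].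
Qed.

(** * The profile curve *)

Definition px (alpha : R -> C) (n : nat) (s : R) : R :=
  Derive_n (fun u => fst (alpha u)) n s.

Definition py (alpha : R -> C) (n : nat) (s : R) : R :=
  Derive_n (fun u => snd (alpha u)) n s.

Definition dist2 (alpha : R -> C) (s : R) : R :=
  px alpha 0 s ^ 2 + py alpha 0 s ^ 2.

Definition radial (alpha : R -> C) (s : R) : R :=
  px alpha 0 s * px alpha 1 s + py alpha 0 s * py alpha 1 s.

Definition speed2 (alpha : R -> C) (s : R) : R :=
  px alpha 1 s ^ 2 + py alpha 1 s ^ 2.

Definition moment (alpha : R -> C) (s : R) : R :=
  px alpha 0 s * py alpha 1 s - py alpha 0 s * px alpha 1 s.

Definition bend (alpha : R -> C) (s : R) : R :=
  px alpha 2 s * py alpha 1 s - py alpha 2 s * px alpha 1 s.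

(** The Gram determinant E G - F^2 of the orbit. *)
Definition gram (omega : R) (alpha : R -> C) (s : R) : R :=
  speed2 alpha s + (omega * radial alpha s) ^ 2.

(** The value of x1 nu1 + x2 nu2 for the normal X_s x X_t / |X_s x X_t|. *)
Definition profile_support (omega : R) (alpha : R -> C) (s : R) : R :=
  moment alpha s / sqrt (gram omega alpha s).

(** The value of 2 H for the normal X_s x X_t / |X_s x X_t|. *)
Definition profile_curvature (omega : R) (alpha : R -> C) (s : R) : R :=
  (bend alpha s * (1 + omega ^ 2 * dist2 alpha s)
     + omega ^ 2 * moment alpha s * speed2 alpha s)
  / (gram omega alpha s * sqrt (gram omega alpha s)).

Lemma is_derive_px (lo hi : Rbar) (alpha : R -> C) (n : nat) (s : R) :
  smooth_curve lo hi alpha -> in_interval lo hi s ->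
  is_derive (px alpha n) s (px alpha (S n) s).
Proof. intros Hsm Hs; apply Derive_correct, (Hsm (S n) s Hs). Qed.

Lemma is_derive_py (lo hi : Rbar) (alpha : R -> C) (n : nat) (s : R) :
  smooth_curve lo hi alpha -> in_interval lo hi s ->
  is_derive (py alpha n) s (py alpha (S n) s).
Proof. intros Hsm Hs; apply Derive_correct, (Hsm (S n) s Hs). Qed.

Lemma ex_derive_px (lo hi : Rbar) (alpha : R -> C) (n : nat) (s : R) :
  smooth_curve lo hi alpha -> in_interval lo hi s -> ex_derive (px alpha n) s.
Proof. intros Hsm Hs; eexists; now apply is_derive_px with lo hi. Qed.

Lemma ex_derive_py (lo hi : Rbar) (alpha : R -> C) (n : nat) (s : R) :
  smooth_curve lo hi alpha -> in_interval lo hi s -> ex_derive (py alpha n) s.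
Proof. intros Hsm Hs; eexists; now apply is_derive_py with lo hi. Qed.

Lemma Derive_px (alpha : R -> C) (n : nat) (s : R) :
  Derive (fun u => px alpha n u) s = px alpha (S n) s.
Proof. reflexivity. Qed.

Lemma Derive_py (alpha : R -> C) (n : nat) (s : R) :
  Derive (fun u => py alpha n u) s = py alpha (S n) s.
Proof. reflexivity. Qed.

Lemma is_derive_dist2 (lo hi : Rbar) (alpha : R -> C) (s : R) :
  smooth_curve lo hi alpha -> in_interval lo hi s ->
  is_derive (dist2 alpha) s (2 * radial alpha s).
Proof.
  intros Hsm Hs; unfold dist2, radial; auto_derive.
  - repeat split; eauto using ex_derive_px, ex_derive_py.
  - rewrite !Derive_px, !Derive_py; ring.
Qed.

Lemma is_derive_radial (lo hi : Rbar) (alpha : R -> C) (s : R) :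
  smooth_curve lo hi alpha -> in_interval lo hi s ->
  is_derive (radial alpha) s
    (speed2 alpha s + px alpha 0 s * px alpha 2 s + py alpha 0 s * py alpha 2 s).
Proof.
  intros Hsm Hs; unfold radial, speed2; auto_derive.
  - repeat split; eauto using ex_derive_px, ex_derive_py.
  - rewrite !Derive_px, !Derive_py; ring.
Qed.

(** The reason why the proposition holds: along the profile curve the support
    function varies at the rate - 2 H (R^2)' / 2. *)
Lemma is_derive_profile_support (lo hi : Rbar) (omega : R) (alpha : R -> C)
    (s : R) :
  smooth_curve lo hi alpha -> in_interval lo hi s -> 0 < gram omega alpha s ->
  is_derive (profile_support omega alpha) s
    (- (radial alpha s * profile_curvature omega alpha s)).
Proof.
  intros Hsm Hs Hpos.
  assert (Hsq : 0 < sqrt (gram omega alpha s)) by now apply sqrt_lt_R0.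
  assert (Hsq2 : sqrt (gram omega alpha s) * sqrt (gram omega alpha s)
                 = gram omega alpha s) by (apply sqrt_sqrt; lra).
  assert (Hm : is_derive (moment alpha) s
    (px alpha 0 s * py alpha 2 s - py alpha 0 s * px alpha 2 s)).
  { unfold moment; auto_derive.
    - repeat split; eauto using ex_derive_px, ex_derive_py.
    - rewrite !Derive_px, !Derive_py; ring. }
  assert (Hg : is_derive (gram omega alpha) s
    (2 * (px alpha 1 s * px alpha 2 s + py alpha 1 s * py alpha 2 s)
     + 2 * omega ^ 2 * radial alpha s
       * (speed2 alpha s + px alpha 0 s * px alpha 2 s
          + py alpha 0 s * py alpha 2 s))).
  { unfold gram, speed2, radial; auto_derive.
    - repeat split; eauto using ex_derive_px, ex_derive_py.
    - rewrite !Derive_px, !Derive_py; ring. }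
  unfold profile_support.
  auto_derive.
  - repeat split; [eexists; eassumption | eexists; eassumption | lra | lra].
  - rewrite (is_derive_unique (fun u : R => moment alpha u) _ _ Hm).
    rewrite (is_derive_unique (fun u : R => gram omega alpha u) _ _ Hg).
    unfold profile_curvature.
    set (w := sqrt (gram omega alpha s)) in *.
    rewrite <- Hsq2.
    apply Rmult_eq_reg_r with (w ^ 3); [ | apply pow_nonzero; lra].
    field_simplify; try lra.
    replace (w ^ 2) with (gram omega alpha s) by (rewrite <- Hsq2; ring).
    unfold gram, bend, dist2, moment, speed2, radial; field.
Qed.

Lemma ex_derive_profile_curvature (lo hi : Rbar) (omega : R) (alpha : R -> C)
    (s : R) :
  smooth_curve lo hi alpha -> in_interval lo hi s -> 0 < gram omega alpha s ->
  ex_derive (profile_curvature omega alpha) s.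
Proof.
  intros Hsm Hs Hpos.
  assert (Hsq : 0 < sqrt (gram omega alpha s)) by now apply sqrt_lt_R0.
  assert (Hprod : gram omega alpha s * sqrt (gram omega alpha s) <> 0) by nra.
  unfold profile_curvature, gram, speed2, radial, bend, dist2, moment in *.
  auto_derive; simpl in *.
  repeat split; eauto using ex_derive_px, ex_derive_py.
Qed.

Lemma gram_pos_of_speed2 (omega : R) (alpha : R -> C) (s : R) :
  0 < speed2 alpha s -> 0 < gram omega alpha s.
Proof.
  intros Hpos; unfold gram; pose proof (pow2_ge_0 (omega * radial alpha s)); lra.
Qed.

(** * The geometry of the orbit *)

Lemma orbit_frame (omega : R) (alpha : R -> C) (s t : R) :
  helicoidal_orbit omega alpha s t
  = frame omega t (px alpha 0 s) (py alpha 0 s) t.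
Proof.
  unfold helicoidal_orbit, helicoidal_motion, frame, px, py; simpl.
  rewrite Rplus_0_l, <- surjective_pairing; reflexivity.
Qed.

Lemma axis_dist2_orbit (omega : R) (alpha : R -> C) (s t : R) :
  axis_dist2 (helicoidal_orbit omega alpha) s t = dist2 alpha s.
Proof.
  unfold axis_dist2, dist2; rewrite orbit_frame.
  rewrite <- !Rsqr_pow2; apply frame_horizontal_dot.
Qed.

Lemma orbit_partial_t (omega : R) (alpha : R -> C) (s t : R) :
  partial_t (helicoidal_orbit omega alpha) s t
  = frame omega t (omega * py alpha 0 s) (- (omega * px alpha 0 s)) 1.
Proof.
  apply partial_t_frame with 0; intros t'.
  rewrite orbit_frame; f_equal; ring.
Qed.

Lemma orbit_partial_tt (omega : R) (alpha : R -> C) (s t : R) :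
  partial_t (partial_t (helicoidal_orbit omega alpha)) s t
  = frame omega t (- (omega ^ 2 * px alpha 0 s))
      (- (omega ^ 2 * py alpha 0 s)) 0.
Proof.
  rewrite (partial_t_frame omega _ s t (omega * py alpha 0 s)
             (- (omega * px alpha 0 s)) 1 0).
  - f_equal; ring.
  - intros t'; rewrite orbit_partial_t; f_equal; ring.
Qed.

Lemma orbit_partial_s (lo hi : Rbar) (omega : R) (alpha : R -> C) (s t : R) :
  smooth_curve lo hi alpha -> in_interval lo hi s ->
  partial_s (helicoidal_orbit omega alpha) s t
  = frame omega t (px alpha 1 s) (py alpha 1 s) 0.
Proof.
  intros Hsm Hs.
  apply partial_s_frame with (px alpha 0) (py alpha 0) t.
  - apply filter_forall; intros u; apply orbit_frame.
  - now apply is_derive_px with lo hi.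
  - now apply is_derive_py with lo hi.
Qed.

Lemma orbit_partial_ss (lo hi : Rbar) (omega : R) (alpha : R -> C) (s t : R) :
  smooth_curve lo hi alpha -> in_interval lo hi s ->
  partial_s (partial_s (helicoidal_orbit omega alpha)) s t
  = frame omega t (px alpha 2 s) (py alpha 2 s) 0.
Proof.
  intros Hsm Hs.
  apply partial_s_frame with (px alpha 1) (py alpha 1) 0.
  - generalize (in_interval_locally lo hi s Hs); apply filter_imp.
    intros u Hu; now apply orbit_partial_s with lo hi.
  - now apply is_derive_px with lo hi.
  - now apply is_derive_py with lo hi.
Qed.

Lemma orbit_partial_ts (lo hi : Rbar) (omega : R) (alpha : R -> C) (s t : R) :
  smooth_curve lo hi alpha -> in_interval lo hi s ->
  partial_s (partial_t (helicoidal_orbit omega alpha)) s t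
  = frame omega t (omega * py alpha 1 s) (- (omega * px alpha 1 s)) 0.
Proof.
  intros Hsm Hs.
  apply partial_s_frame with (fun u => omega * py alpha 0 u)
    (fun u => - (omega * px alpha 0 u)) 1.
  - apply filter_forall; intros u; apply orbit_partial_t.
  - apply is_derive_scal; now apply is_derive_py with lo hi.
  - apply @is_derive_opp, is_derive_scal; now apply is_derive_px with lo hi.
Qed.

(** If alpha'(s) = 0, then X_s = 0. *)
Lemma immersion_gram_pos (lo hi : Rbar) (omega : R) (alpha : R -> C) (s : R) :
  smooth_curve lo hi alpha ->
  immersion (strip lo hi) (helicoidal_orbit omega alpha) ->
  in_interval lo hi s -> 0 < gram omega alpha s.
Proof.
  intros Hsm Himm Hs; apply gram_pos_of_speed2.
  destruct (Rle_lt_dec (speed2 alpha s) 0) as [Hle | Hlt]; [exfalso | exact Hlt].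
  assert (Hx : px alpha 1 s = 0) by (unfold speed2 in Hle; nra).
  assert (Hy : py alpha 1 s = 0) by (unfold speed2 in Hle; nra).
  destruct (Himm s 0 Hs 1 0) as [H1 _]; [ | | | lra];
    rewrite (orbit_partial_s lo hi) by assumption;
    rewrite frame_eq0 by auto; unfold x1, x2, x3; simpl; ring.
Qed.

(** The cross product X_s x X_t. *)
Definition conormal (omega : R) (alpha : R -> C) (s t : R) : R3 :=
  frame omega t (py alpha 1 s) (- px alpha 1 s) (- (omega * radial alpha s)).

(** The sign that compares nu with X_s x X_t. *)
Definition orientation (omega : R) (alpha : R -> C) (nu : R -> R -> R3)
    (s t : R) : R :=
  dot (nu s t) (conormal omega alpha s t) / sqrt (gram omega alpha s).

(** A vector orthogonal to X_s and X_t is a multiple of X_s x X_t, and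
    |X_s x X_t|^2 is the Gram determinant. *)
Lemma unit_normal_orbit (lo hi : Rbar) (omega : R) (alpha : R -> C)
    (nu : R -> R -> R3) (s t : R) :
  oriented_helicoidal_surface omega lo hi alpha nu -> in_interval lo hi s ->
  let eps := orientation omega alpha nu s t in
  let m := eps / sqrt (gram omega alpha s) in
  eps ^ 2 = 1 /\
  nu s t = frame omega t (m * py alpha 1 s) (- (m * px alpha 1 s))
             (- (m * (omega * radial alpha s))).
Proof.
  intros (Homega & _ & Hsm & Himm & Hnu) Hs eps m.
  pose proof (immersion_gram_pos lo hi omega alpha s Hsm Himm Hs) as Hpos.
  assert (Hsq : 0 < sqrt (gram omega alpha s)) by now apply sqrt_lt_R0.
  assert (Hsq2 : sqrt (gram omega alpha s) * sqrt (gram omega alpha s)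
                 = gram omega alpha s) by (apply sqrt_sqrt; lra).
  destruct (Hnu s t Hs) as (_ & Hunit & Hds & Hdt).
  rewrite (orbit_partial_s lo hi) in Hds by assumption.
  rewrite orbit_partial_t in Hdt.
  assert (Heps : eps * sqrt (gram omega alpha s)
                 = dot (nu s t) (conormal omega alpha s t)).
  { unfold eps, orientation; field; lra. }
  assert (Hm : m * gram omega alpha s
               = dot (nu s t) (conormal omega alpha s t)).
  { rewrite <- Heps; unfold m; rewrite <- Hsq2 at 2; field; lra. }
  assert (Heps2 : eps ^ 2 = m ^ 2 * gram omega alpha s).
  { unfold m; rewrite <- Hsq2 at 2; field; lra. }
  clearbody m; clearbody eps.
  destruct (frame_surjective omega t (nu s t)) as (u & v & z & Hframe).
  unfold conormal in *.
  rewrite Hframe in *; rewrite !frame_dot in *.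
  unfold gram, speed2, radial in *.
  set (x := px alpha 0 s) in *; set (y := py alpha 0 s) in *.
  set (dx := px alpha 1 s) in *; set (dy := py alpha 1 s) in *.
  set (W := dx ^ 2 + dy ^ 2 + (omega * (x * dx + y * dy)) ^ 2) in *.
  set (p := omega * (x * dx + y * dy)) in *.
  (* With N = X_s x X_t, these are the components of the identity
     |N|^2 nu = (nu . N) N + (nu . X_t) (N x X_s) - (nu . X_s) (N x X_t). *)
  assert (Hu : u = m * dy).
  { apply Rmult_eq_reg_r with W; [ | lra].
    transitivity (m * W * dy
      + (u * (omega * y) + v * - (omega * x) + z * 1) * (p * dy)
      - (u * dx + v * dy + z * 0) * (- dx - p * (omega * x))).
    - rewrite Hm; unfold W, p; ring.
    - rewrite Hds, Hdt; ring. }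
  assert (Hv : v = - (m * dx)).
  { apply Rmult_eq_reg_r with W; [ | lra].
    transitivity (m * W * - dx
      + (u * (omega * y) + v * - (omega * x) + z * 1) * - (p * dx)
      - (u * dx + v * dy + z * 0) * (- dy - p * (omega * y))).
    - rewrite Hm; unfold W, p; ring.
    - rewrite Hds, Hdt; ring. }
  assert (Hz : z = - (m * p)).
  { apply Rmult_eq_reg_r with W; [ | lra].
    transitivity (m * W * - p
      + (u * (omega * y) + v * - (omega * x) + z * 1) * (dx ^ 2 + dy ^ 2)
      - (u * dx + v * dy + z * 0) * (omega * (y * dx - x * dy))).
    - rewrite Hm; unfold W, p; ring.
    - rewrite Hds, Hdt; ring. }
  split.
  - rewrite Heps2, <- Hunit, Hu, Hv, Hz; unfold W; ring.
  - rewrite Hu, Hv, Hz; reflexivity.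
Qed.

Lemma mean_curvature_orbit (lo hi : Rbar) (omega : R) (alpha : R -> C)
    (nu : R -> R -> R3) (s t : R) :
  oriented_helicoidal_surface omega lo hi alpha nu -> in_interval lo hi s ->
  2 * mean_curvature (helicoidal_orbit omega alpha) nu s t
  = orientation omega alpha nu s t * profile_curvature omega alpha s.
Proof.
  intros Hsurf Hs.
  destruct (unit_normal_orbit lo hi omega alpha nu s t Hsurf Hs) as [_ Hnu].
  destruct Hsurf as (_ & _ & Hsm & Himm & _).
  pose proof (immersion_gram_pos lo hi omega alpha s Hsm Himm Hs) as Hpos.
  assert (Hsq : 0 < sqrt (gram omega alpha s)) by now apply sqrt_lt_R0.
  unfold mean_curvature.
  rewrite (orbit_partial_ss lo hi), (orbit_partial_ts lo hi),
    (orbit_partial_s lo hi) by assumption.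
  rewrite orbit_partial_tt, orbit_partial_t, Hnu, !frame_dot.
  set (w := sqrt (gram omega alpha s)) in *.
  set (eps := orientation omega alpha nu s t).
  match goal with |- 2 * (_ / (2 * ?d)) = _ =>
    replace d with (gram omega alpha s)
      by (unfold gram, speed2, radial; ring) end.
  unfold profile_curvature; fold w.
  apply Rmult_eq_reg_r with (gram omega alpha s * w);
    [ | apply Rmult_integral_contrapositive; lra].
  field_simplify; try lra.
  unfold bend, dist2, moment, speed2; ring.
Qed.

Lemma Qhat_orbit (lo hi : Rbar) (omega : R) (alpha : R -> C)
    (nu : R -> R -> R3) (s t : R) :
  oriented_helicoidal_surface omega lo hi alpha nu -> in_interval lo hi s ->
  Qhat (helicoidal_orbit omega alpha) nu s t
  = orientation omega alpha nu s t * profile_support omega alpha s.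
Proof.
  intros Hsurf Hs.
  destruct (unit_normal_orbit lo hi omega alpha nu s t Hsurf Hs) as [_ Hnu].
  unfold Qhat; rewrite Hnu, orbit_frame, frame_horizontal_dot.
  unfold profile_support, moment, Rdiv; ring.
Qed.

Lemma continuous_components (f : R -> R3) (s : R) :
  continuous (f : R -> C * R) s ->
  continuous (fun u => x1 (f u)) s /\ continuous (fun u => x2 (f u)) s /\
  continuous (fun u => x3 (f u)) s.
Proof.
  intros Hf; unfold x1, x2, x3.
  assert (Hfst : continuous (fun u => fst (f u)) s).
  { apply (continuous_comp f fst); [exact Hf | ].
    destruct (f s); apply continuous_fst. }
  repeat split.
  - apply (continuous_comp (fun u => fst (f u)) fst); [exact Hfst | ].
    destruct (fst (f s)); apply continuous_fst.
  - apply (continuous_comp (fun u => fst (f u)) snd); [exact Hfst | ].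
    destruct (fst (f s)); apply continuous_snd.
  - apply (continuous_comp f snd); [exact Hf | ].
    destruct (f s); apply continuous_snd.
Qed.

Lemma continuous_dot (f g : R -> R3) (s : R) :
  continuous (f : R -> C * R) s ->
  ex_derive (fun u => x1 (g u)) s -> ex_derive (fun u => x2 (g u)) s ->
  ex_derive (fun u => x3 (g u)) s ->
  continuous (fun u => dot (f u) (g u)) s.
Proof.
  intros Hf H1 H2 H3; unfold dot.
  destruct (continuous_components f s Hf) as (Hf1 & Hf2 & Hf3).
  repeat apply (continuous_plus (V := R_NormedModule));
    apply (continuous_mult (K := R_AbsRing));
    try assumption; now apply @ex_derive_continuous.
Qed.

Lemma orientation_continuous_s (lo hi : Rbar) (omega : R) (alpha : R -> C)
    (nu : R -> R -> R3) (s t : R) :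
  oriented_helicoidal_surface omega lo hi alpha nu -> in_interval lo hi s ->
  continuous (fun u => orientation omega alpha nu u t) s.
Proof.
  intros (_ & _ & Hsm & Himm & Hnu) Hs.
  pose proof (immersion_gram_pos lo hi omega alpha s Hsm Himm Hs) as Hpos.
  destruct (Hnu s t Hs) as [Hcont _].
  unfold orientation, Rdiv.
  apply (continuous_mult (K := R_AbsRing)
    (fun u => dot (nu u t) (conormal omega alpha u t))).
  - apply continuous_dot.
    + apply (continuous_comp_2 (fun u : R => u) (fun _ : R => t)
        (fun u v => nu u v : C * R)).
      * apply continuous_id.
      * apply continuous_const.
      * exact Hcont.
    + unfold conormal, frame, radial, x1, expNi, Cmult; simpl; auto_derive.
      repeat split; eauto using ex_derive_px, ex_derive_py.
    + unfold conormal, frame, radial, x2, expNi, Cmult; simpl; auto_derive.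
      repeat split; eauto using ex_derive_px, ex_derive_py.
    + unfold conormal, frame, radial, x3; simpl; auto_derive.
      repeat split; eauto using ex_derive_px, ex_derive_py.
  - apply (ex_derive_continuous (K := R_AbsRing) (V := R_NormedModule)).
    assert (Hsq : sqrt (gram omega alpha s) <> 0)
      by (apply Rgt_not_eq, sqrt_lt_R0, Hpos).
    unfold gram, speed2, radial in *; auto_derive; simpl in *.
    repeat split; eauto using ex_derive_px, ex_derive_py.
Qed.

Lemma orientation_continuous_t (lo hi : Rbar) (omega : R) (alpha : R -> C)
    (nu : R -> R -> R3) (s t : R) :
  oriented_helicoidal_surface omega lo hi alpha nu -> in_interval lo hi s ->
  continuous (fun v => orientation omega alpha nu s v) t.
Proof.
  intros (_ & _ & Hsm & Himm & Hnu) Hs.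
  destruct (Hnu s t Hs) as [Hcont _].
  unfold orientation, Rdiv.
  apply (continuous_mult (K := R_AbsRing)
    (fun v => dot (nu s v) (conormal omega alpha s v)));
    [ | apply continuous_const].
  apply continuous_dot.
  - apply (continuous_comp_2 (fun _ : R => s) (fun v : R => v)
      (fun u v => nu u v : C * R)).
    + apply continuous_const.
    + apply continuous_id.
    + exact Hcont.
  - unfold conormal, frame, x1, expNi, Cmult; simpl; auto_derive; exact I.
  - unfold conormal, frame, x2, expNi, Cmult; simpl; auto_derive; exact I.
  - unfold conormal, frame, x3; simpl; auto_derive; exact I.
Qed.

(** The strip is connected by paths made of one segment in the direction of t and
    one in the direction of s, so continuity in each variable is enough. *)
Lemma orientation_constant (lo hi : Rbar) (omega : R) (alpha : R -> C)
    (nu : R -> R -> R3) (s t s' t' : R) :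
  oriented_helicoidal_surface omega lo hi alpha nu ->
  in_interval lo hi s -> in_interval lo hi s' ->
  orientation omega alpha nu s t = orientation omega alpha nu s' t'.
Proof.
  intros Hsurf Hs Hs'.
  transitivity (orientation omega alpha nu s t').
  - apply (continuous_sign_constant m_infty p_infty
             (fun v => orientation omega alpha nu s v)).
    + intros v _; now apply orientation_continuous_t with lo hi.
    + intros v _; now apply (unit_normal_orbit lo hi).
    + split; exact I.
    + split; exact I.
  - apply (continuous_sign_constant lo hi
             (fun u => orientation omega alpha nu u t')); auto.
    + intros u Hu; now apply orientation_continuous_s with lo hi.
    + intros u Hu; now apply (unit_normal_orbit lo hi).
Qed.

(** * The critical equation along the profile curve *)

(** On an arc of a circle about the origin the curvature is governed by
    alpha . alpha'' = - |alpha'|^2, whence 2 H = - Qhat / R^2 there. *)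
Lemma profile_curvature_on_arc (lo hi : Rbar) (omega : R) (alpha : R -> C)
    (s : R) :
  smooth_curve lo hi alpha -> in_interval lo hi s -> 0 < gram omega alpha s ->
  locally s (fun u => radial alpha u = 0) ->
  0 < dist2 alpha s /\
  dist2 alpha s * profile_curvature omega alpha s
  = - profile_support omega alpha s.
Proof.
  intros Hsm Hs Hpos Harc.
  assert (Hsq : 0 < sqrt (gram omega alpha s)) by now apply sqrt_lt_R0.
  assert (Hp : radial alpha s = 0) by exact (locally_singleton _ _ Harc).
  assert (Hdp : px alpha 0 s * px alpha 2 s + py alpha 0 s * py alpha 2 s
                = - speed2 alpha s).
  { assert (Hzero : is_derive (radial alpha) s 0).
    { apply is_derive_ext_loc with (fun _ => 0); [ | apply @is_derive_const].
      revert Harc; apply filter_imp; auto. }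
    pose proof (is_derive_radial lo hi alpha s Hsm Hs) as Hd.
    apply is_derive_unique in Hzero; apply is_derive_unique in Hd; lra. }
  assert (Hgram : gram omega alpha s = speed2 alpha s)
    by (unfold gram; rewrite Hp; ring).
  split.
  - destruct (Rle_lt_dec (dist2 alpha s) 0) as [Hle | Hlt]; [exfalso | exact Hlt].
    assert (Hx : px alpha 0 s = 0) by (unfold dist2 in Hle; nra).
    assert (Hy : py alpha 0 s = 0) by (unfold dist2 in Hle; nra).
    rewrite Hx, Hy in Hdp; lra.
  - assert (Hbend : dist2 alpha s * bend alpha s
                    = - (moment alpha s * speed2 alpha s)).
    { transitivity
        ((px alpha 0 s * px alpha 2 s + py alpha 0 s * py alpha 2 s)
           * moment alpha s
         - (px alpha 0 s * py alpha 2 s - py alpha 0 s * px alpha 2 s)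
           * radial alpha s).
      - unfold dist2, bend, moment, radial; ring.
      - rewrite Hdp, Hp; ring. }
    unfold profile_curvature, profile_support.
    transitivity
      ((dist2 alpha s * bend alpha s * (1 + omega ^ 2 * dist2 alpha s)
        + omega ^ 2 * dist2 alpha s * (moment alpha s * speed2 alpha s))
       / (gram omega alpha s * sqrt (gram omega alpha s))).
    + field; lra.
    + rewrite Hbend, <- Hgram; field; lra.
Qed.

(** On the arc rho (2 H) = - Qhat, where rho and Qhat are stationary and
    rho > 0. *)
Lemma profile_curvature_stationary_on_arc (lo hi : Rbar) (omega : R)
    (alpha : R -> C) (s : R) :
  smooth_curve lo hi alpha ->
  (forall u, in_interval lo hi u -> 0 < gram omega alpha u) ->
  in_interval lo hi s -> locally s (fun u => radial alpha u = 0) ->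
  is_derive (profile_curvature omega alpha) s 0.
Proof.
  intros Hsm Hpos Hs Harc.
  destruct (profile_curvature_on_arc lo hi omega alpha s Hsm Hs (Hpos s Hs) Harc)
    as [Hrho _].
  destruct (ex_derive_profile_curvature lo hi omega alpha s Hsm Hs (Hpos s Hs))
    as [l Hl].
  assert (Hp : radial alpha s = 0) by exact (locally_singleton _ _ Harc).
  assert (Hprod : is_derive
    (fun u => dist2 alpha u * profile_curvature omega alpha u) s
    (2 * radial alpha s * profile_curvature omega alpha s + dist2 alpha s * l)).
  { apply (is_derive_mult (K := R_AbsRing)); [ | exact Hl | exact Rmult_comm].
    now apply is_derive_dist2 with lo hi. }
  assert (Hsupp : is_derive
    (fun u => dist2 alpha u * profile_curvature omega alpha u) s
    (- - (radial alpha s * profile_curvature omega alpha s))).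
  { apply is_derive_ext_loc with (fun u => - profile_support omega alpha u).
    - apply locally_locally in Harc.
      generalize (filter_and _ _ Harc (in_interval_locally lo hi s Hs)).
      apply filter_imp; intros u [Hu Iu]; symmetry.
      apply (profile_curvature_on_arc lo hi omega alpha u Hsm Iu (Hpos u Iu) Hu).
    - apply @is_derive_opp.
      apply is_derive_profile_support with lo hi; auto. }
  apply is_derive_unique in Hprod; apply is_derive_unique in Hsupp.
  rewrite Hprod, Hp in Hsupp.
  replace 0 with l; [exact Hl | ].
  apply Rmult_eq_reg_l with (dist2 alpha s); lra.
Qed.

(** The parameter eps stands for the constant sign of the chosen normal. *)
Definition defect (a Lambda0 omega eps : R) (alpha : R -> C) (s : R) : R :=
  eps * profile_curvature omega alpha s - Lambda0 + a / 2 * dist2 alpha s.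

Definition first_integral (a Lambda0 omega eps : R) (alpha : R -> C) (s : R) :
    R :=
  2 * (eps * profile_support omega alpha s) + Lambda0 * dist2 alpha s
    - a / 4 * dist2 alpha s ^ 2.

Lemma is_derive_first_integral (lo hi : Rbar) (a Lambda0 omega eps : R)
    (alpha : R -> C) (s : R) :
  smooth_curve lo hi alpha -> in_interval lo hi s -> 0 < gram omega alpha s ->
  is_derive (first_integral a Lambda0 omega eps alpha) s
    (- (2 * radial alpha s * defect a Lambda0 omega eps alpha s)).
Proof.
  intros Hsm Hs Hpos.
  pose proof (is_derive_dist2 lo hi alpha s Hsm Hs) as Hrho.
  pose proof (is_derive_profile_support lo hi omega alpha s Hsm Hs Hpos) as Hq.
  unfold first_integral; auto_derive.
  - repeat split; eexists; eassumption.
  - rewrite (is_derive_unique (fun u : R => dist2 alpha u) _ _ Hrho).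
    rewrite (is_derive_unique (fun u : R => profile_support omega alpha u) _ _ Hq).
    unfold defect; field.
Qed.

(** If radial * defect = 0, the square of the defect is stationary everywhere:
    at a zero of the defect by the chain rule, elsewhere because radial vanishes
    in a neighbourhood, which makes the profile an arc of a circle there.  The
    square serves to treat the zeros without any topology of the zero set. *)
Lemma defect_square_constant (lo hi : Rbar) (a Lambda0 omega eps : R)
    (alpha : R -> C) :
  smooth_curve lo hi alpha ->
  (forall s, in_interval lo hi s -> 0 < gram omega alpha s) ->
  (forall s, in_interval lo hi s ->
     radial alpha s * defect a Lambda0 omega eps alpha s = 0) ->
  forall s s', in_interval lo hi s -> in_interval lo hi s' ->
  defect a Lambda0 omega eps alpha s ^ 2 = defect a Lambda0 omega eps alpha s' ^ 2.
Proof.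
  intros Hsm Hpos Hprod.
  apply (derive_zero_constant lo hi
           (fun s => defect a Lambda0 omega eps alpha s ^ 2)).
  intros s Hs.
  destruct (ex_derive_profile_curvature lo hi omega alpha s Hsm Hs (Hpos s Hs))
    as [l Hl].
  pose proof (is_derive_dist2 lo hi alpha s Hsm Hs) as Hrho.
  assert (Hd : is_derive (defect a Lambda0 omega eps alpha) s
                 (eps * l + a * radial alpha s)).
  { unfold defect; auto_derive.
    - repeat split; eexists; eassumption.
    - rewrite (is_derive_unique (fun u : R => dist2 alpha u) _ _ Hrho).
      rewrite (is_derive_unique (fun u : R => profile_curvature omega alpha u)
                 _ _ Hl); field. }
  assert (Hsq : is_derive (fun u => defect a Lambda0 omega eps alpha u ^ 2) s
    (2 * defect a Lambda0 omega eps alpha s * (eps * l + a * radial alpha s))).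
  { auto_derive.
    - repeat split; eexists; eassumption.
    - rewrite (is_derive_unique
        (fun u : R => defect a Lambda0 omega eps alpha u) _ _ Hd); ring. }
  replace 0 with
    (2 * defect a Lambda0 omega eps alpha s * (eps * l + a * radial alpha s));
    [exact Hsq | ].
  destruct (Req_dec (defect a Lambda0 omega eps alpha s) 0) as [H0 | Hne].
  { rewrite H0; ring. }
  assert (Harc : locally s (fun u => radial alpha u = 0)).
  { assert (Hcont : continuous (defect a Lambda0 omega eps alpha) s).
    { apply (ex_derive_continuous (K := R_AbsRing) (V := R_NormedModule)).
      eexists; exact Hd. }
    assert (Hnear : locally s (fun u => defect a Lambda0 omega eps alpha u <> 0)).
    { exact (Hcont (fun v => v <> 0) (open_neq 0 _ Hne)). }
    generalize (filter_and _ _ Hnear (in_interval_locally lo hi s Hs)).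
    apply filter_imp; intros u [Hu Iu].
    destruct (Rmult_integral _ _ (Hprod u Iu)); [assumption | contradiction]. }
  assert (Hl0 : l = 0).
  { rewrite <- (is_derive_unique _ _ _ Hl); apply is_derive_unique.
    now apply profile_curvature_stationary_on_arc with lo hi. }
  rewrite Hl0, (locally_singleton _ _ Harc); ring.
Qed.

(* On a round cylinder about the vertical axis the function below is always
   constant, whatever a and Lambda0 are, while the cylinder is critical only
   for special values; hence the proviso in the converse direction. *)
Theorem proposition1p1 (a Lambda0 omega : R) (lo hi : Rbar)
    (alpha : R -> C) (nu : R -> R -> R3)
    (hSigma : oriented_helicoidal_surface omega lo hi alpha nu) :
  let D := strip lo hi in
  let X := helicoidal_orbit omega alpha in
  let h := fun s t =>
    2 * Qhat X nu s t + Lambda0 * axis_dist2 X s t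
      - a / 4 * axis_dist2 X s t ^ 2 in
  (critical_point a Lambda0 D X nu -> constant_on D h) /\
  (~ in_round_cylinder D X ->
   constant_on D h -> critical_point a Lambda0 D X nu).
Proof.
  intros D X h.
  assert (Hsurf := hSigma).
  destruct Hsurf as (_ & Hlt & Hsm & Himm & _).
  assert (Hpos : forall s, in_interval lo hi s -> 0 < gram omega alpha s).
  { intros s Hs; now apply immersion_gram_pos with lo hi. }
  destruct (in_interval_inhabited lo hi Hlt) as [s0 Hs0].
  set (eps := orientation omega alpha nu s0 0).
  assert (Heps : forall s t, in_interval lo hi s ->
                   orientation omega alpha nu s t = eps).
  { intros s t Hs; now apply orientation_constant with lo hi. }
  assert (Hh : forall s t, in_interval lo hi s ->
                 h s t = first_integral a Lambda0 omega eps alpha s).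
  { intros s t Hs; unfold h, X, first_integral.
    rewrite (Qhat_orbit lo hi), axis_dist2_orbit, Heps by assumption.
    reflexivity. }
  assert (Hcrit : forall s t, in_interval lo hi s ->
    defect a Lambda0 omega eps alpha s
    = 2 * mean_curvature X nu s t - (Lambda0 - a / 2 * axis_dist2 X s t)).
  { intros s t Hs; unfold X, defect.
    rewrite (mean_curvature_orbit lo hi), axis_dist2_orbit, Heps by assumption.
    ring. }
  split.
  - intros Hcp; exists (first_integral a Lambda0 omega eps alpha s0).
    intros s t Hs; rewrite Hh by assumption.
    apply (derive_zero_constant lo hi); try assumption.
    intros u Hu.
    replace 0 with (- (2 * radial alpha u * defect a Lambda0 omega eps alpha u)).
    + now apply is_derive_first_integral with lo hi; auto.
    + rewrite (Hcrit u 0 Hu), (Hcp u 0 Hu); ring.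
  - intros Hcyl [c Hc] s t Hs.
    assert (Hprod : forall u, in_interval lo hi u ->
              radial alpha u * defect a Lambda0 omega eps alpha u = 0).
    { intros u Hu.
      assert (Hzero : is_derive (first_integral a Lambda0 omega eps alpha) u 0).
      { apply is_derive_ext_loc with (fun _ => c); [ | apply @is_derive_const].
        generalize (in_interval_locally lo hi u Hu); apply filter_imp.
        intros v Hv; rewrite <- (Hh v 0 Hv); symmetry; now apply Hc. }
      pose proof (is_derive_first_integral lo hi a Lambda0 omega eps alpha u
                    Hsm Hu (Hpos u Hu)) as Hd.
      apply is_derive_unique in Hzero; apply is_derive_unique in Hd; lra. }
    destruct (Req_dec (defect a Lambda0 omega eps alpha s) 0) as [H0 | Hne].
    { rewrite (Hcrit s t Hs) in H0; lra. }
    (* The square of the defect is a nonzero constant, so radial vanishes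
       identically. *)
    exfalso; apply Hcyl; exists (dist2 alpha s0).
    intros u v Hu; unfold X; rewrite axis_dist2_orbit.
    apply (derive_zero_constant lo hi); try assumption.
    intros w Hw.
    replace 0 with (2 * radial alpha w); [now apply is_derive_dist2 with lo hi | ].
    destruct (Rmult_integral _ _ (Hprod w Hw)) as [Hp | H0];
      [rewrite Hp; ring | ].
    exfalso; apply Hne.
    pose proof (defect_square_constant lo hi a Lambda0 omega eps alpha
                  Hsm Hpos Hprod s w Hs Hw) as Hsq.
    rewrite H0 in Hsq; nra.
Qed.
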